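(* Let $L$ be a finite lattice and $\mathbf{m}$ a maximal chain of $L$. Then $\mathbf{m}$ is a chief chain of $L$ if and only if $L$ is graded and every element $m$ of $\mathbf{m}$ is rank modular, i.e. satisfies $\rho(m\vee x)+\rho(m\wedge x)=\rho(m)+\rho(x)$ for all $x\in L$, where $\rho$ is the rank function of $L$.
   Context: A maximal chain $\mathbf{m}$ of a lattice $L$ is a chief chain if for every chain $\mathbf{c}$ of $L$, the sublattice generated by $\mathbf{m}\cup\mathbf{c}$ is distributive. A finite lattice is graded if all its maximal chains have the same length; its rank function $\rho$ assigns to $x$ the length of any maximal chain of $[\hat 0,x]$. *)

(* Defs.v *)
From mathcomp Require Import all_boot all_order.

Set Implicit Arguments.
Unset Strict Implicit.
Unset Printing Implicit Defensive.

Import Order.Theory.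
Local Open Scope order_scope.

Section LatticeChains.
(* [finTBLatticeType] is the MathComp structure of nonempty finite lattices,
   with [\bot] the least element. *)
Context {d : Order.disp_t} {L : finTBLatticeType d}.
Implicit Types (x y z : L) (A C S : {set L}).

Definition chain C : bool := [forall x in C, forall y in C, x >=< y].

Definition max_chain_in S C : bool :=
  maxset [pred C' : {set L} | chain C' & C' \subset S] C.

Definition max_chain C : bool := max_chain_in [set: L] C.

Definition chain_length C : nat := #|C|.-1.

Definition sublattice S : bool :=
  [forall x in S, forall y in S, (x `&` y \in S) && (x `|` y \in S)].

Definition generated_sublattice A : {set L} :=
  \bigcap_(S : {set L} | sublattice S && (A \subset S)) S.

Definition distributive_on S : Prop :=
  {in S & &, left_distributive (@Order.meet d L) (@Order.join d L)}.

Definition chief_chain C : Prop :=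
  max_chain C /\
  forall c : {set L}, chain c -> distributive_on (generated_sublattice (C :|: c)).

Definition graded : Prop :=
  forall C1 C2 : {set L},
    max_chain C1 -> max_chain C2 -> chain_length C1 = chain_length C2.

Definition lower_interval x : {set L} := [set y | \bot <= y <= x].

(* A total definition, the longest of the maximal chains of [\bot, x]; in a
   graded lattice they all have this length, by [rank_max_chain] below. *)
Definition rank x : nat :=
  (\max_(C : {set L} | max_chain_in (lower_interval x) C) chain_length C)%N.

Definition rank_modular y : Prop :=
  forall x, (rank (y `|` x)%O + rank (y `&` x)%O = rank y + rank x)%N.

Lemma chainP C : reflect {in C &, forall x y, x >=< y} (chain C).
Proof.
apply: (iffP idP) => [/forall_inP h x y xC yC|h].
  by move/forall_inP: (h x xC); apply.
by apply/forall_inP => x xC; apply/forall_inP => y yC; apply: h.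
Qed.

Lemma sublatticeP S :
  reflect (Order.ClosedPredicates.meet_closed S /\ Order.ClosedPredicates.join_closed S) (sublattice S).
Proof.
apply: (iffP idP) => [/forall_inP h|[hm hj]].
  by split=> x y xS yS; move/forall_inP: (h x xS) => /(_ y yS) /andP[].
apply/forall_inP => x xS; apply/forall_inP => y yS.
by rewrite hm // hj.
Qed.

Lemma max_chain_inP S C :
  reflect [/\ chain C, C \subset S
            & forall x, x \in S -> {in C, forall y, x >=< y} -> x \in C]
          (max_chain_in S C).
Proof.
apply: (iffP maxsetP) => [[/andP[cC CS] h]|[cC CS h]].
  split=> // x xS xC; suff <-: x |: C = C by rewrite setU11.
  apply: h; last exact: subsetUr.
  rewrite /= subUset sub1set xS CS !andbT; apply/chainP => u v.
  rewrite !in_setU1 => /predU1P[->|uC] /predU1P[->|vC].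
  - exact: comparablexx.
  - exact: xC.
  - by rewrite comparable_sym xC.
  - by move/chainP: cC; apply.
split; first by rewrite /= cC CS.
move=> B /andP[/chainP cB BS] CB; apply/eqP; rewrite eqEsubset CB andbT.
apply/subsetP => x xB; apply: h => [|y yC]; first exact: (subsetP BS).
by apply: cB => //; apply: (subsetP CB).
Qed.

Lemma max_chain_in_exists S : {C | max_chain_in S C}.
Proof.
have [|C mC _] := @maxset_exists _ [pred C' : {set L} | chain C' & C' \subset S] set0.
  by rewrite /= sub0set andbT; apply/chainP => x; rewrite inE.
by exists C.
Qed.

Lemma graded_lower_chains x C1 C2 : graded ->
  max_chain_in (lower_interval x) C1 -> max_chain_in (lower_interval x) C2 ->
  chain_length C1 = chain_length C2.
Proof.
move=> gr.
have [D /max_chain_inP[cD DS Dm]] := max_chain_in_exists [set y | x <= y].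
have xD : x \in D.
  apply: Dm; first by rewrite inE.
  by move=> y /(subsetP DS); rewrite inE => /le_comparable.
have key C : max_chain_in (lower_interval x) C ->
    max_chain (C :|: D) /\ (#|C :|: D| + 1 = #|C| + #|D|)%N.
  move=> /max_chain_inP[cC CS Cm].
  have Cx y : y \in C -> y <= x.
    by move/(subsetP CS); rewrite inE => /andP[].
  have Dx y : y \in D -> x <= y by move/(subsetP DS); rewrite inE.
  have xC : x \in C.
    apply: Cm; first by rewrite inE le0x lexx.
    by move=> y yC; apply: ge_comparable; apply: Cx.
  split.
    apply/max_chain_inP; split; last 1 first.
    - move=> z _ h; rewrite inE.
      have /orP[zx|xz] : z >=< x by apply: h; rewrite inE xC.
        apply/orP; left; apply: Cm; first by rewrite inE le0x zx.
        by move=> y yC; apply: h; rewrite inE yC.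
      apply/orP; right; apply: Dm; first by rewrite inE.
      by move=> y yD; apply: h; rewrite inE yD orbT.
    - apply/chainP => u v; rewrite !inE => /orP[uC|uD] /orP[vC|vD].
      + by move/chainP: cC; apply.
      + by apply: le_comparable; apply: le_trans (Cx _ uC) (Dx _ vD).
      + by apply: ge_comparable; apply: le_trans (Cx _ vC) (Dx _ uD).
      + by move/chainP: cD; apply.
    - exact: subsetT.
  rewrite -cardsUI; congr (_ + _)%N.
  suff -> : C :&: D = [set x] by rewrite cards1.
  apply/setP => y; rewrite !inE; apply/andP/eqP => [[/Cx yx /Dx xy]|-> //].
  by apply/le_anti; rewrite yx xy.
move=> /key[m1 e1] /key[m2 e2]; have := gr _ _ m1 m2; rewrite /chain_length.
have p1 : (0 < #|C1 :|: D|)%N by apply/card_gt0P; exists x; rewrite inE xD orbT.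
have p2 : (0 < #|C2 :|: D|)%N by apply/card_gt0P; exists x; rewrite inE xD orbT.
move=> /(congr1 succn); rewrite !prednK // => e.
by congr _.-1; apply/eqP; rewrite -(eqn_add2r #|D|) -e1 -e2 e.
Qed.

Lemma rank_max_chain x C :
  graded -> max_chain_in (lower_interval x) C -> rank x = chain_length C.
Proof.
move=> gr mC; apply/eqP; rewrite eqn_leq; apply/andP; split.
  by apply/bigmax_leqP => C' mC'; rewrite (graded_lower_chains gr mC' mC).
exact: (@leq_bigmax_cond _ _ chain_length).
Qed.

End LatticeChains.

Arguments graded {d} L.

(* Main.v *)
(* Label each element [x] of [L] by the set [J x] of steps [p < j] of the maximal
   chain [m] that [x] collapses upwards: [p `|` x = j `|` x].

   If [m] is a chief chain, [J] is a lattice morphism on every distributive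
   sublattice containing [m], and [#|J x|] grows by one along each cover [x < z],
   as one sees in the sublattice generated by [m], [x] and [z]. Hence [#|J x|] is
   a rank function, and it is modular because [J] turns joins and meets into
   unions and intersections.

   Conversely, rank modularity along [m] shows that, for [y] in [m], exactly
   [rank (y `&` x)] elements of [J x] lie below [y]. So [#|J x| = rank x], and by
   counting [J] preserves the join and meet of an element of [m] with any element.
   Given a chain [c], call [x] two-sided when each [k \in J x] already belongs to
   the label of some [a `&` b] below [x], and each [k \notin J x] is missed by the
   label of some [a `|` b] above [x], with [a] in [m] and [b] in [c]. Two-sided
   elements form a sublattice on which [J] is a morphism, and [J] is injective on
   it because rank is strictly monotone. *)
Require Import Defs.
From mathcomp Require Import all_boot all_order.
From mathcomp Require Import zify.

Set Implicit Arguments.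
Unset Strict Implicit.
Unset Printing Implicit Defensive.

Import Order.Theory.

Section ChiefChains.
Local Open Scope order_scope.
Context {d : Order.disp_t} {L : finTBLatticeType d}.
Implicit Types (x y z p a b : L) (A C S c m : {set L}).

(** * Generated sublattices *)

Lemma sub_generated A : A \subset generated_sublattice A.
Proof. by apply/bigcapsP => S /andP[]. Qed.

Lemma generated_sub A S :
  sublattice S -> A \subset S -> generated_sublattice A \subset S.
Proof. by move=> hS AS; apply: bigcap_inf; rewrite hS. Qed.

Lemma generated_sublatticeP A : sublattice (generated_sublattice A).
Proof.
apply/sublatticeP; split=> x y /bigcapP hx /bigcapP hy; apply/bigcapP => S hS;
  have /andP[/sublatticeP[hm hj] _] := hS.
- by apply: hm; [apply: hx|apply: hy].
- by apply: hj; [apply: hx|apply: hy].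
Qed.

(** * Covers and consecutive elements of a chain *)

Definition covers x z : Prop := x < z /\ forall w, x < w -> w <= z -> w = z.

Definition step_in C p y : Prop :=
  [/\ p \in C, y \in C, p < y & {in C, forall u, u < y -> u <= p}].

Lemma chain_step C y : chain C -> y \in C -> \bot \in C -> y != \bot ->
  exists p, step_in C p y.
Proof.
move=> /chainP cC yC C0 y0.
pose P u := (u \in C) && (u < y).
have P0 : P \bot by rewrite /P C0 lt0x.
(* Down-sets grow strictly with [u], so maximising their size selects the greatest [u] of [C] below
   [y]. *)
case: (@arg_maxnP _ _ P (fun u => #|[set v : L | v <= u]|) P0) => p /andP[pC py] pmax.
exists p; split=> // u uC uy; case/orP: (cC _ _ uC pC) => // pu.
have pu' : P u by rewrite /P uC.
have [->//|neq] := eqVneq u p.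
suff /proper_card : [set v | v <= p] \proper [set v | v <= u]
  by rewrite ltnNge => /negP[]; exact: pmax.
apply/properP; split; first by apply/subsetP => v; rewrite !inE => /le_trans; apply.
exists u; rewrite inE ?lexx //; apply/negP => up.
by case/eqP: neq; apply: le_anti; rewrite up.
Qed.

Lemma chain_step_ind C (P : L -> Prop) : chain C -> \bot \in C -> P \bot ->
  (forall p y, step_in C p y -> P p -> P y) -> {in C, forall y, P y}.
Proof.
move=> cC C0 P0 Pstep y; have [n] := ubnP #|[set v : L | v <= y]|.
elim: n y => // n IH y hn yC.
have [->//|y0] := eqVneq y \bot.
have [p sp] := chain_step cC yC C0 y0; have [pC _ py _] := sp.
apply: (Pstep _ _ sp); apply: IH => //.
rewrite ltnS in hn; apply: leq_trans hn; apply: proper_card.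
apply/properP; split; first by apply/subsetP => v; rewrite !inE => /le_trans;
  apply; exact: ltW.
by exists y; rewrite inE ?lexx // (lt_geF py).
Qed.

Lemma step_leE C p y u : chain C -> step_in C p y -> u \in C ->
  (u <= y) = (u == y) || (u <= p).
Proof.
move=> cC [pC yC py hp] uC; rewrite le_eqVlt; congr orb.
by apply/idP/idP => [/(hp _ uC)//|/le_lt_trans]; apply.
Qed.

(** The larger of two chain elements is one of them, so it inherits [P]; this merges two witnesses
    into one. *)
Lemma chain_max C (P : pred L) a1 a2 : chain C -> a1 \in C -> a2 \in C -> P a1 -> P a2 ->
  exists a, [/\ a \in C, P a, a1 <= a & a2 <= a].
Proof.
move=> /chainP cC a1C a2C p1 p2; case/orP: (cC _ _ a1C a2C) => h.
  by exists a2.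
by exists a1.
Qed.

Lemma chain_min C (P : pred L) a1 a2 : chain C -> a1 \in C -> a2 \in C -> P a1 -> P a2 ->
  exists a, [/\ a \in C, P a, a <= a1 & a <= a2].
Proof.
move=> /chainP cC a1C a2C p1 p2; case/orP: (cC _ _ a1C a2C) => h.
  by exists a1.
by exists a2.
Qed.

Lemma chain_bounded c : chain c -> chain (\bot |: (\top |: c)).
Proof.
move=> /chainP cc; apply/chainP => u v; rewrite !inE.
move=> /or3P[/eqP->|/eqP->|uc] /or3P[/eqP->|/eqP->|vc]; last exact: cc;
  by rewrite /Order.comparable ?lex1 ?le0x ?orbT.
Qed.

(** * Maximal chains below an element *)

Section LowerChain.
Variables (x : L) (C : {set L}).
Hypothesis mC : max_chain_in (lower_interval x) C.

Lemma lower_chain : chain C.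
Proof. by case/max_chain_inP: mC. Qed.

Lemma lower_chain_bot : \bot \in C.
Proof.
case/max_chain_inP: mC => _ _; apply; first by rewrite inE lexx le0x.
by move=> y _; apply: le_comparable; exact: le0x.
Qed.

Lemma lower_chain_le y : y \in C -> y <= x.
Proof. by case/max_chain_inP: mC => _ /subsetP h _ /h; rewrite inE le0x. Qed.

Lemma lower_chain_top : x \in C.
Proof.
case/max_chain_inP: mC => _ _; apply; first by rewrite inE lexx le0x.
by move=> y /lower_chain_le; exact: ge_comparable.
Qed.

(** An element above [p] and at most [y] is comparable with all of [C], so maximality puts it in
    [C], where only [y] remains. *)
Lemma lower_chain_covers p y : step_in C p y -> covers p y.
Proof.
move=> sp; have [pC yC py hp] := sp; split=> // z pz zy.
have zC : z \in C.
  case/max_chain_inP: mC => cC _; apply.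
    by rewrite inE le0x (le_trans zy) // lower_chain_le.
  move=> u uC; have /orP[uy|yu] := chainP _ cC _ _ uC yC.
    move: uy; rewrite (step_leE cC sp uC) => /orP[/eqP->|up].
      exact: le_comparable.
    by apply: ge_comparable; rewrite (le_trans up) // ltW.
  by apply: le_comparable; exact: le_trans yu.
apply/eqP/negPn/negP => zny.
have : z <= p by apply: hp; rewrite // lt_neqAle zny.
by rewrite (lt_geF pz).
Qed.

End LowerChain.

Lemma max_chain_lower C : max_chain C = max_chain_in (lower_interval \top) C.
Proof.
by congr max_chain_in; apply/setP => y; rewrite !inE le0x lex1.
Qed.

(** * Rank functions and the rank *)

Section RankFunction.
Variable f : L -> nat.
Hypothesis f0 : f \bot = 0%N.
Hypothesis fS : forall x z, covers x z -> f z = (f x).+1.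

Lemma rank_function_length x C :
  max_chain_in (lower_interval x) C -> chain_length C = f x.
Proof.
move=> mC; have cC := lower_chain mC; have C0 := lower_chain_bot mC.
(* The count includes [\bot], hence the successor, which the predecessor in [chain_length] cancels
   at [y = x]. *)
suff /(_ x (lower_chain_top mC)) : {in C, forall y, #|[set u in C | u <= y]| = (f y).+1}.
  have -> : [set u in C | u <= x] = C.
    apply/setP => u; rewrite inE; by apply: andb_idr => /(lower_chain_le mC).
  by rewrite /chain_length => ->.
apply: (chain_step_ind cC C0).
  rewrite f0 -(cards1 (\bot : L)); congr #|pred_of_set _|; apply/setP => u.
  by rewrite !inE lex0; apply: andb_idl => /eqP->.
move=> p y sp IH; have [pC yC py _] := sp.
rewrite (fS (lower_chain_covers mC sp)) -IH.
have -> : [set u in C | u <= y] = y |: [set u in C | u <= p].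
  apply/setP => u; rewrite !inE; have [uC|uNC] /= := boolP (u \in C).
    exact: step_leE cC sp uC.
  by rewrite orbF; apply/esym/negbTE; apply: contraNneq uNC => ->.
by rewrite cardsU1 inE yC (lt_geF py).
Qed.

Lemma rank_function_graded : graded L.
Proof.
by move=> C1 C2; rewrite !max_chain_lower => /rank_function_length -> /rank_function_length ->.
Qed.

Lemma rank_functionE x : rank x = f x.
Proof.
have [C mC] := max_chain_in_exists (lower_interval x).
by rewrite (rank_max_chain rank_function_graded mC) (rank_function_length mC).
Qed.

End RankFunction.

Lemma rank_bot : rank (\bot : L) = 0%N.
Proof.
apply/eqP; rewrite -leqn0; apply/bigmax_leqP => C mC.
suff /subset_leq_card : C \subset [set \bot] by rewrite cards1 /chain_length; lia.
by apply/subsetP => y /(lower_chain_le mC); rewrite lex0 inE.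
Qed.

(** A longest maximal chain below [x] stays a chain when [y] is added, and extends to a maximal
    chain below [y]. *)
Lemma rank_lt x y : x < y -> (rank x < rank y)%N.
Proof.
move=> xy; have [C0 mC0] := max_chain_in_exists (lower_interval x).
rewrite {1}/rank (bigop.bigmax_eq_arg C0) //.
case: arg_maxnP => // C mC _.
have [C' mC' sub] : {C' | max_chain_in (lower_interval y) C' & y |: C \subset C'}.
  apply: maxset_exists; rewrite /= subUset sub1set inE le0x lexx /=.
  have hC u : u \in C -> u <= y.
    by move/(lower_chain_le mC)/le_trans; apply; exact: ltW.
  apply/andP; split; last by apply/subsetP => u /hC; rewrite inE le0x.
  apply/chainP => u v; rewrite !inE => /predU1P[->|uC] /predU1P[->|vC].
  - exact: comparablexx.
  - by apply: ge_comparable; exact: hC.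
  - by apply: le_comparable; exact: hC.
  - by move/chainP: (lower_chain mC); apply.
apply: leq_trans (@leq_bigmax_cond _ _ chain_length C' mC').
have := subset_leq_card sub; rewrite cardsU1.
have -> : y \notin C by apply/negP => /(lower_chain_le mC); rewrite (lt_geF xy).
have : (0 < #|C|)%N by apply/card_gt0P; exists x; exact: lower_chain_top mC.
by rewrite /chain_length; lia.
Qed.

Lemma rank_le x y : x <= y -> (rank x <= rank y)%N.
Proof. by rewrite le_eqVlt => /predU1P[->//|/rank_lt/ltnW]. Qed.

(** Adding [z] to a maximal chain below [x] gives a maximal chain below [z]: an element comparable
    with all of it is at most [x] or, by the cover, equal to [z]. *)
Lemma rank_covers x z : graded L -> covers x z -> rank z = (rank x).+1.
Proof.
move=> gr [xz hz]; have [C mC] := max_chain_in_exists (lower_interval x).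
have xC := lower_chain_top mC.
have hC u : u \in C -> u <= z.
  by move/(lower_chain_le mC)/le_trans; apply; exact: ltW.
have mC' : max_chain_in (lower_interval z) (z |: C).
  apply/max_chain_inP; split.
  - apply/chainP => u v; rewrite !inE => /predU1P[->|uC] /predU1P[->|vC].
    + exact: comparablexx.
    + by apply: ge_comparable; exact: hC.
    + by apply: le_comparable; exact: hC.
    + by move/chainP: (lower_chain mC); apply.
  - apply/subsetP => u; rewrite !inE le0x => /predU1P[->|/hC] //; exact: lexx.
  move=> w; rewrite !inE le0x /= => wz hw.
  have /orP[wx|xw] : w >=< x by apply: hw; rewrite inE xC orbT.
    case/max_chain_inP: mC => _ _ -> //; rewrite ?orbT ?inE ?le0x //.
    by move=> u uC; apply: hw; rewrite inE uC orbT.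
  move: xw; rewrite le_eqVlt => /predU1P[<-|xw]; first by rewrite xC orbT.
  by rewrite (hz w) ?eqxx.
rewrite (rank_max_chain gr mC) (rank_max_chain gr mC') /chain_length cardsU1.
have -> : z \notin C by apply/negP => /(lower_chain_le mC); rewrite (lt_geF xz).
have : (0 < #|C|)%N by apply/card_gt0P; exists x.
by lia.
Qed.

(** * Labels by collapsed steps *)

Section Label.
Variable m : {set L}.
Hypothesis hm : max_chain m.

Let mm : max_chain_in (lower_interval \top) m.
Proof. by rewrite -max_chain_lower. Qed.
Let cm : chain m := lower_chain mm.
Let m0 : \bot \in m := lower_chain_bot mm.
Let m1 : \top \in m := lower_chain_top mm.

(** A step is recorded by its upper end [j]. Any [u < j] in [m] may witness the collapse, since the
    condition passes up to the predecessor of [j]; so no predecessor has to be chosen. *)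
Definition label x : {set L} :=
  [set j in m | [exists u in m, (u < j) && (j <= u `|` x)]].

Lemma label_mono x y : x <= y -> label x \subset label y.
Proof.
move=> xy; apply/subsetP => j; rewrite !inE => /andP[-> /exists_inP[u um /andP[uj h]]].
by apply/exists_inP; exists u; rewrite // uj (le_trans h) // leU2.
Qed.

Lemma label_step p j x : step_in m p j -> (j \in label x) = (j <= p `|` x).
Proof.
move=> [pm jm pj hp]; rewrite inE jm; apply/exists_inP/idP => [[u um /andP[uj h]]|h].
  by rewrite (le_trans h) // leU2 // hp.
by exists p; rewrite // pj.
Qed.

Lemma labelP x j : j \in label x -> exists p, step_in m p j.
Proof.
rewrite inE => /andP[jm /exists_inP[u um /andP[uj _]]].
by apply: chain_step => //; apply: contraTneq uj => ->; rewrite ltx0.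
Qed.

(** The meet lies between [p] and [j], and [j] covers [p]; were it [j], the step would collapse. *)
Lemma step_meet_join p j x :
  step_in m p j -> j \notin label x -> j `&` (p `|` x) = p.
Proof.
move=> sp; rewrite (label_step _ sp); have [_ hj] := lower_chain_covers mm sp.
have [_ _ pj _] := sp; apply: contraNeq => h.
by rewrite leEmeet; apply/eqP; apply: hj; rewrite ?leIl //
  lt_neqAle eq_sym h lexI ltW ?leUl.
Qed.

Lemma label_chain y : y \in m -> label y = [set j in m | (j != \bot) && (j <= y)].
Proof.
move=> ym; apply/setP => j; rewrite !inE; have [jm|//] := boolP (j \in m).
apply/exists_inP/idP => /= [[u um /andP[uj h]]|/andP[j0 jy]].
  apply/andP; split; first by apply: contraTneq uj => ->; rewrite ltx0.
  have /orP[uy|yu] := chainP _ cm _ _ um ym; first by move: h; rewrite (join_r uy).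
  by move: h; rewrite (join_l yu) (lt_geF uj).
by exists \bot; rewrite // lt0x j0 join0x.
Qed.

Lemma label_bot : label \bot = set0.
Proof.
by rewrite label_chain //; apply/setP => j; rewrite !inE lex0 andNb andbF.
Qed.

(** * Labels on a distributive sublattice containing the chain *)

Section Distributive.
Variable D : {set L}.
Hypothesis mD : m \subset D.
Hypothesis subD : sublattice D.
Hypothesis distD : distributive_on D.

Let meetD x y : x \in D -> y \in D -> x `&` y \in D.
Proof. by case/sublatticeP: subD => h _; apply: h. Qed.
Let joinD x y : x \in D -> y \in D -> x `|` y \in D.
Proof. by case/sublatticeP: subD => _ h; apply: h. Qed.

Lemma distributive_joinIr p x y : p \in D -> x \in D -> y \in D ->
  (p `|` x) `&` (p `|` y) = p `|` (x `&` y).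
Proof.
move=> pD xD yD; rewrite distD ?joinD // joinKI [x `&` _]meetC distD //.
by rewrite joinA meetKU meetC.
Qed.

Lemma label_meet : {in D &, {morph label : x y / x `&` y >-> x :&: y}}.
Proof.
move=> x y xD yD; apply/eqP; rewrite eqEsubset subsetI !label_mono ?leIl ?leIr //=.
apply/subsetP => j /setIP[jx jy]; have [p sp] := labelP jx; have [pm _ _ _] := sp.
move: jx jy; rewrite !(label_step _ sp) => jx jy.
by rewrite -distributive_joinIr ?lexI ?jx // (subsetP mD).
Qed.

Lemma label_join : {in D &, {morph label : x y / x `|` y >-> x :|: y}}.
Proof.
move=> x y xD yD; apply/eqP; rewrite eqEsubset subUset !label_mono ?leUl ?leUr //= andbT.
apply/subsetP => j jxy; have [p sp] := labelP jxy; have [pm jm _ _] := sp.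
have [pD jD] := (subsetP mD _ pm, subsetP mD _ jm).
rewrite inE; have [//|/(step_meet_join sp) jx] := boolP (j \in label x).
move: jxy; rewrite !(label_step _ sp) => /meet_l e.
(* Distribute [j] over the join of [p]|[x] and [p]|[y], which is above [j]; the first part
   contributes only [p]. *)
have <- : p `|` ((p `|` y) `&` j) = j.
  by rewrite -{1}jx [j `&` _]meetC -distD ?joinD // joinACA joinxx meetC.
by rewrite leUx leUl leIl.
Qed.

Lemma label_covers x z : x \in D -> z \in D -> covers x z ->
  #|label z| = #|label x|.+1.
Proof.
move=> xD zD [xz hz].
(* Climbing [m] from [\bot] to [\top], this is a step at which the meet with [z] stops being below
   [x]. Its upper end [k] will be the one new label. *)
have [p [k [sp zp zk]]] : exists p k,
    [/\ step_in m p k, z `&` p <= x & ~~ (z `&` k <= x)].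
  have : {in m, forall y, z `&` y <= x \/
      exists p k, [/\ step_in m p k, z `&` p <= x & ~~ (z `&` k <= x)]}.
    apply: (chain_step_ind cm m0) => [|p k sp [zp|]];
      [by left; rewrite meetx0 le0x| |by right].
    by case: (boolP (z `&` k <= x)) => [|zk]; [left|right; exists p, k].
  by case/(_ _ m1) => //; rewrite meetx1 (lt_geF xz).
have [pm km pk _] := sp; have [pD kD] := (subsetP mD _ pm, subsetP mD _ km).
have kx : k \notin label x.
  rewrite (label_step _ sp); apply: contra zk => kpx.
  have : z `&` k <= (p `|` x) `&` z by rewrite meetC leI2.
  move/le_trans; apply; rewrite distD // leUx leIl.
  by rewrite meetC zp.
have kz : k \in label z.
  apply: contraNT zk => /(step_meet_join sp) e; apply: le_trans zp.
  by rewrite lexI leIl -e lexI leIr (le_trans (leIl _ _)) ?leUr.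
have ez : x `|` (z `&` k) = z.
  apply: hz; last by rewrite leUx (ltW xz) leIl.
  by rewrite lt_neqAle leUl andbT eq_sym; rewrite joinC -leEjoin zk.
suff -> : label z = k |: label x by rewrite cardsU1 kx.
(* By [ez], a label of [z] outside [label x] is also a label of [k]. If it is not [k], it is at most
   [p], hence a label of [z]&[p], which is below [x]. *)
apply/eqP; rewrite eqEsubset subUset sub1set kz label_mono ?ltW // !andbT.
apply/subsetP => j; rewrite -{1}ez label_join ?meetD // label_meet //
  in_setU in_setI in_setU1.
have [_|jx] /= := boolP (j \in label x); first by rewrite orbT.
rewrite orbF => /andP[jz]; rewrite label_chain // !inE => /and3P[jm j0].
rewrite (step_leE cm sp jm) => /orP[//|jp]; case/negP: jx.
apply: (subsetP (label_mono zp)); rewrite label_meet // inE jz label_chain // inE.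
by rewrite jm j0.
Qed.

End Distributive.

(** * Labels along a rank modular chain *)

Section RankModular.
Hypothesis gr : graded L.
Hypothesis rm : forall y, y \in m -> rank_modular y.

(** From [p] to [y] the rank in [m] grows by one, so by modularity exactly one of the ranks of the
    meet and the join with [x] grows, by one. It is the meet exactly when the join is unchanged,
    that is when [y] is a label of [x]. *)
Lemma card_label_le x : {in m, forall y, #|[set j in label x | j <= y]| = rank (y `&` x)}.
Proof.
apply: (chain_step_ind cm m0).
  rewrite meet0x rank_bot; apply: eq_card0 => j; rewrite inE lex0.
  apply/negP => /andP[jx /eqP j0]; move: (subsetP (label_mono (lex1 x)) _ jx).
  by rewrite label_chain // j0 !inE eqxx andbF.
move=> p y sp IH; have [pm ym py _] := sp.
have ry := rank_covers gr (lower_chain_covers mm sp).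
have := rm ym x; have := rm pm x.
have pxy : p `|` x <= y `|` x by rewrite leU2 // ltW.
have mxy : (rank (p `&` x) <= rank (y `&` x))%N by rewrite rank_le // leI2 // ltW.
have -> : [set j in label x | j <= y] =
    [set j in label x | (j == y) || (j <= p)].
  apply/setP => j; rewrite !inE; have [jm|//] := boolP (j \in m).
  by rewrite (step_leE cm sp jm).
have [yx|yNx] := boolP (y \in label x).
  have -> : [set j in label x | (j == y) || (j <= p)] =
      y |: [set j in label x | j <= p].
    move: (label x) yx => J yJ; apply/setP => j; rewrite !inE.
    by case: eqVneq => [->|//]; rewrite yJ.
  rewrite cardsU1 !inE (lt_geF py) andbF IH.
  have -> : y `|` x = p `|` x.
    by apply: le_anti; rewrite pxy leUx leUr -(label_step _ sp) yx.
  by lia.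
have -> : [set j in label x | (j == y) || (j <= p)] = [set j in label x | j <= p].
  move: (label x) yNx => J yNJ; apply/setP => j; rewrite !inE.
  by case: eqVneq => [->|//]; rewrite (negbTE yNJ).
rewrite IH; suff : (rank (p `|` x) < rank (y `|` x))%N by lia.
apply: rank_lt; rewrite lt_neqAle pxy andbT; apply: contraNneq yNx => e.
by rewrite (label_step _ sp) e leUl.
Qed.

Lemma card_label x : #|label x| = rank x.
Proof.
rewrite -[x in RHS]meet1x -card_label_le //; congr #|pred_of_set _|.
by move: (label x) => J; apply/setP => j; rewrite inE lex1 andbT.
Qed.

(** One inclusion is monotonicity; the common labels are labels of [x] at most [y], so there are at
    most [rank (y]&[x)] of them. *)
Lemma label_chain_meet y x : y \in m -> label (y `&` x) = label y :&: label x.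
Proof.
move=> ym; apply/eqP; rewrite eqEcard subsetI !label_mono ?leIl ?leIr //=.
rewrite card_label -card_label_le // subset_leq_card //; apply/subsetP => j.
rewrite label_chain // in_setI => /andP[jy jx]; move: jx jy.
by move: (label x) => J; rewrite !inE => -> /and3P[].
Qed.

Lemma label_chain_join y x : y \in m -> label (y `|` x) = label y :|: label x.
Proof.
move=> ym; apply/esym/eqP; rewrite eqEcard subUset !label_mono ?leUl ?leUr //=.
rewrite -(leq_add2r #|label y :&: label x|) cardsUI -label_chain_meet //.
by rewrite !card_label (rm ym).
Qed.

Lemma label_inj_le x y : x <= y -> label x = label y -> x = y.
Proof.
rewrite le_eqVlt => /predU1P[//|/rank_lt]; rewrite -!card_label => h e.
by rewrite e ltnn in h.
Qed.

(** * Two-sided elements *)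

Section TwoSided.
Variable c : {set L}.
Hypothesis cc : chain c.
Hypothesis c0 : \bot \in c.
Hypothesis c1 : \top \in c.

(** As [a] lies in [m], membership in both labels amounts to membership in the label of [a]&[b];
    dually for [outside]. *)
Definition inside x k := [exists a in m, exists b in c,
  [&& a `&` b <= x, k \in label a & k \in label b]].
Definition outside x k := [exists a in m, exists b in c,
  [&& x <= a `|` b, k \notin label a & k \notin label b]].
Definition two_sided : {set L} := [set x | [forall k, inside x k || outside x k]].

Lemma insideP x k : reflect
  (exists a b, [/\ a \in m, b \in c, a `&` b <= x, k \in label a & k \in label b])
  (inside x k).
Proof.
apply: (iffP exists_inP) => [[a am /exists_inP[b bc /and3P[]]]|[a [b [am bc h ka kb]]]].
  by exists a, b.
by exists a => //; apply/exists_inP; exists b; rewrite // h ka.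
Qed.

Lemma outsideP x k : reflect
  (exists a b, [/\ a \in m, b \in c, x <= a `|` b, k \notin label a & k \notin label b])
  (outside x k).
Proof.
apply: (iffP exists_inP) => [[a am /exists_inP[b bc /and3P[]]]|[a [b [am bc h ka kb]]]].
  by exists a, b.
by exists a => //; apply/exists_inP; exists b; rewrite // h ka.
Qed.

Lemma inside_label x k : inside x k -> k \in label x.
Proof.
case/insideP=> a [b [am bc h ka kb]]; apply: (subsetP (label_mono h)).
by rewrite (label_chain_meet b am) inE ka.
Qed.

Lemma outside_label x k : outside x k -> k \notin label x.
Proof.
case/outsideP=> a [b [am bc h ka kb]]; apply: contra (subsetP (label_mono h) k) _.
by rewrite (label_chain_join b am) inE negb_or ka.
Qed.

Lemma inside_mono x y k : x <= y -> inside x k -> inside y k.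
Proof.
move=> xy /insideP[a [b [am bc h ka kb]]]; apply/insideP.
by exists a, b; split=> //; exact: le_trans xy.
Qed.

Lemma outside_mono x y k : x <= y -> outside y k -> outside x k.
Proof.
move=> xy /outsideP[a [b [am bc h ka kb]]]; apply/outsideP.
by exists a, b; split=> //; exact: le_trans h.
Qed.

(** Since [m] and [c] are chains, the smaller of the two [a] and the smaller of the two [b] still
    carry [k], and their meet is below both elements. *)
Lemma inside_meet x y k : inside x k -> inside y k -> inside (x `&` y) k.
Proof.
move=> /insideP[a1 [b1 [am1 bc1 h1 ka1 kb1]]] /insideP[a2 [b2 [am2 bc2 h2 ka2 kb2]]].
have [a [am ka le1 le2]] := chain_min (P := fun a => k \in label a) cm am1 am2 ka1 ka2.
have [b [bc kb le3 le4]] := chain_min (P := fun b => k \in label b) cc bc1 bc2 kb1 kb2.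
apply/insideP; exists a, b; split=> //.
by rewrite lexI (le_trans _ h1) ?(le_trans _ h2) // leI2.
Qed.

Lemma outside_join x y k : outside x k -> outside y k -> outside (x `|` y) k.
Proof.
move=> /outsideP[a1 [b1 [am1 bc1 h1 ka1 kb1]]] /outsideP[a2 [b2 [am2 bc2 h2 ka2 kb2]]].
have [a [am ka le1 le2]] := chain_max (P := fun a => k \notin label a) cm am1 am2 ka1 ka2.
have [b [bc kb le3 le4]] := chain_max (P := fun b => k \notin label b) cc bc1 bc2 kb1 kb2.
apply/outsideP; exists a, b; split=> //.
by rewrite leUx (le_trans h1) ?(le_trans h2) // leU2.
Qed.

Lemma two_sidedP x k : x \in two_sided -> inside x k \/ outside x k.
Proof. by rewrite inE => /forallP/(_ k)/orP. Qed.

Lemma two_sided_sublattice : sublattice two_sided.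
Proof.
apply/sublatticeP; split=> x y xS yS; rewrite inE; apply/forallP => k; apply/orP;
  have := two_sidedP k xS; have := two_sidedP k yS.
- case=> [iy|oy]; last by right; apply: outside_mono oy; exact: leIr.
  case=> [ix|ox]; last by right; apply: outside_mono ox; exact: leIl.
  by left; exact: inside_meet.
- case=> [iy|oy]; first by left; apply: inside_mono iy; exact: leUr.
  case=> [ix|ox]; first by left; apply: inside_mono ix; exact: leUl.
  by right; exact: outside_join.
Qed.

Lemma two_sided_meet : {in two_sided &, {morph label : x y / x `&` y >-> x :&: y}}.
Proof.
move=> x y xS yS; apply/eqP; rewrite eqEsubset subsetI !label_mono ?leIl ?leIr //=.
apply/subsetP => k /setIP[kx ky]; apply: inside_label; apply: inside_meet.
  by case: (two_sidedP k xS) => // /outside_label/negP.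
by case: (two_sidedP k yS) => // /outside_label/negP.
Qed.

Lemma two_sided_join : {in two_sided &, {morph label : x y / x `|` y >-> x :|: y}}.
Proof.
move=> x y xS yS; apply/eqP; rewrite eqEsubset subUset !label_mono ?leUl ?leUr //= andbT.
apply/subsetP => k; apply: contraLR; rewrite inE negb_or => /andP[kx ky].
apply: outside_label; apply: outside_join.
  by case: (two_sidedP k xS) => // /inside_label/(elimN idP kx).
by case: (two_sidedP k yS) => // /inside_label/(elimN idP ky).
Qed.

(** Equal labels are shared by [x]&[y], which reduces the claim to comparable elements. *)
Lemma label_inj : {in two_sided &, injective label}.
Proof.
move=> x y xS yS e.
have ex : x `&` y = x.
  by apply: label_inj_le; rewrite ?leIl // two_sided_meet // -e setIid.
have ey : x `&` y = y.
  by apply: label_inj_le; rewrite ?leIr // two_sided_meet // -e setIid.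
by rewrite -ex ey.
Qed.

Lemma two_sided_distributive : distributive_on two_sided.
Proof.
have /sublatticeP[sm sj] := two_sided_sublattice.
move=> x y z xS yS zS; apply: label_inj.
- by apply: sm => //; apply: sj.
- by apply: sj; apply: sm.
by rewrite !(two_sided_meet, two_sided_join) ?sm ?sj // setIUl.
Qed.

(** An element of either chain is its own witness, paired with a bound from the other chain: [\top]
    carries every possible label and [\bot] none. *)
Lemma sub_two_sided : m :|: c \subset two_sided.
Proof.
have kT k : k \in label \top = (k \in m) && (k != \bot).
  by rewrite label_chain // inE lex1 andbT.
have kx x k : k \in label x -> k \in label \top.
  by apply: subsetP; apply: label_mono; exact: lex1.
apply/subsetP => x /setUP[] xS; rewrite inE; apply/forallP => k; apply/orP;
  have [h|h] := boolP (k \in label x); [left|right|left|right].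
- by apply/insideP; exists x, \top; split; rewrite ?meetx1 ?lexx // (kx x).
- by apply/outsideP; exists x, \bot; split; rewrite ?joinx0 ?lexx // label_bot inE.
- by apply/insideP; exists \top, x; split; rewrite ?meet1x ?lexx // (kx x).
- by apply/outsideP; exists \bot, x; split; rewrite ?join0x ?lexx // label_bot inE.
Qed.

End TwoSided.
End RankModular.
End Label.

(** * From labels to the equivalence *)

Lemma chief_chain_label m : chief_chain m ->
  [/\ forall x z, covers x z -> #|label m z| = #|label m x|.+1
    & forall y x, y \in m -> (#|label m (y `|` x)| + #|label m (y `&` x)| =
                              #|label m y| + #|label m x|)%N].
Proof.
move=> [hm dist]; split=> [x z xz|y x ym].
  have cxz : chain [set x; z].
    have h : x >=< z by case: xz => /ltW/le_comparable.
    apply/chainP => u v; rewrite !inE => /orP[]/eqP-> /orP[]/eqP->;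
      by rewrite ?comparablexx // comparable_sym.
  have /subsetP sub := sub_generated (m :|: [set x; z]).
  apply: (label_covers hm _ (generated_sublatticeP _) (dist _ cxz)) => //.
  - by apply/subsetP => u um; apply: sub; rewrite inE um.
  - by apply: sub; rewrite !inE eqxx orbT.
  - by apply: sub; rewrite !inE eqxx !orbT.
have cx : chain [set x].
  by apply/chainP => u v; rewrite !inE => /eqP-> /eqP->; exact: comparablexx.
have /subsetP sub := sub_generated (m :|: [set x]).
have mD : m \subset generated_sublattice (m :|: [set x]).
  by apply/subsetP => u um; apply: sub; rewrite inE um.
have yD := subsetP mD _ ym.
have xD : x \in generated_sublattice (m :|: [set x]).
  by apply: sub; rewrite !inE eqxx orbT.
rewrite (label_join hm mD (generated_sublatticeP _) (dist _ cx)) //.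
by rewrite (label_meet hm mD (generated_sublatticeP _) (dist _ cx)) // cardsUI.
Qed.

End ChiefChains.

Theorem theorem1p4 (d : Order.disp_t) (L : finTBLatticeType d) (m : {set L})
    (hm : max_chain m) :
  chief_chain m <-> (graded L /\ forall y : L, y \in m -> rank_modular y).
Proof.
split=> [cm|[gr rm]].
  have [lS lM] := chief_chain_label cm.
  have l0 : #|label m \bot%O| = 0 by rewrite label_bot // cards0.
  split=> [|y ym x]; first exact: (rank_function_graded l0 lS).
  by rewrite !(rank_functionE l0 lS) lM.
(* The bounds are adjoined to [c] to serve as witnesses in [sub_two_sided]; the sublattice generated
   with [c] itself still consists of two-sided elements. *)
split=> // c cc; have cc' := chain_bounded cc.
have c0 : \bot%O \in \bot%O |: (\top%O |: c) by rewrite !inE eqxx.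
have c1 : \top%O \in \bot%O |: (\top%O |: c) by rewrite !inE eqxx orbT.
have /subsetP sub : generated_sublattice (m :|: c) \subset
    two_sided m (\bot%O |: (\top%O |: c)).
  apply: generated_sub; first exact: two_sided_sublattice.
  apply: subset_trans (sub_two_sided hm c0 c1).
  by rewrite setUS // setUA subsetUr.
move=> x y z /sub xS /sub yS /sub zS.
exact: (two_sided_distributive hm gr rm cc').
Qed.
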